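(* Let $\mu$ be an inductive valuation on $K(x)$ and let $$\mu_0\xrightarrow{(\phi_1,\lambda_1)}\mu_1\xrightarrow{(\phi_2,\lambda_2)}\cdots\xrightarrow{(\phi_r,\lambda_r)}\mu_r=\mu$$ be an optimal MacLane chain of $\mu$. Then $[\phi_1,\dots,\phi_r]$ is an Okutsu frame of every strong key polynomial $F$ for $\mu$, and $C_i(F)=C_i(\mu)$ for all $1\le i\le r$.
   Context: **Valuations.** $K$ is a field with a discrete valuation $v\colon K^*\to\mathbb{Z}$, $v(K^* )=\mathbb{Z}$, valuation ring $\mathcal{O}$. $K_v$ is the completion, $\mathcal{O}_v$ its valuation ring, and $v$ also denotes its canonical extension to a fixed algebraic closure $\overline{K}_v$, $v\colon\overline K_v\to\mathbb{Q}\cup\{\infty\}$. $\mathbb{V}$ is the set of discrete valuations $\mu\colon K(x)^*\to\mathbb{Q}$ with $\mu|_K=v$, $\mu(x)\ge0$; put $\mu(0)=\infty$, $\Gamma(\mu)=\mu(K(x)^* )$. $\mu_0\in\mathbb{V}$ is given by $\mu_0(\sum_s a_sx^s)=\min_s v(a_s)$. **Graded algebra.** For $\alpha\in\Gamma(\mu)$, $\mathcal P_\alpha=\{g\in K[x]:\mu(g)\ge\alpha\}$, $\mathcal P_\alpha^+=\{g\in K[x]:\mu(g)>\alpha\}$, $\mathcal{G}r(\mu)=\bigoplus_{\alpha}\mathcal P_\alpha/\mathcal P_\alpha^+$, $H_\mu(0)=0$ and $H_\mu(g)=g+\mathcal P^+_{\mu(g)}$ for $g\ne0$; $h\mid_\mu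 g$ means that $H_\mu(h)$ divides $H_\mu(g)$ in $\mathcal{G}r(\mu)$. **Key polynomials, chains.** A key polynomial for $\mu$ is a monic $\phi\in K[x]$ of positive degree such that $H_\mu(\phi)\mathcal{G}r(\mu)$ is a non-zero prime ideal and $\phi\nmid_\mu g$ for all non-zero $g$ with $\deg g<\deg\phi$. (Key polynomials lie in $\mathcal{O}[x]$ and are irreducible in $K_v[x]$.) For such $\phi$ and $\lambda\in\mathbb{Q}_{>0}$, $[\mu;(\phi,\lambda)]\in\mathbb V$ is the valuation $\sum_s g_s\phi^s\mapsto\min_s\{\mu(g_s\phi^s)+s\lambda\}$ on $\phi$-expansions ($\deg g_s<\deg\phi$). A valuation $\mu$ is inductive if it is obtained from $\mu_0$ by finitely many augmentations $\mu_i=[\mu_{i-1};(\phi_i,\lambda_i)]$, with $\phi_i$ a key polynomial for $\mu_{i-1}$ and $\lambda_i\in\mathbb{Q}_{>0}$; the chain is an optimal MacLane chain if $\deg\phi_1<\cdots<\deg\phi_r$. All optimal MacLane chains of $\mu$ have the same length $r$ (the depth of $\mu$) and the same $m_r(\mu):=\deg\phi_r$ and $C_i(\mu):=\mu_i(\phi_i)/\deg\phi_i$ ($1\le i\le r$). A key polynomial $\phi$ for $\mu$ is strong if $r=0$ or $\deg\phi>m_r(\mu)$. **Okutsu frames.** A prime polynomial is a monic irreducible polynomial in $\mathcal{O}_v[x]$. Let $F$ be a prime polynomial with root $\theta\in\overline K_v$. Let $F_1,\dots,F_r\in\mathcal{O}[x]$ be monic with $1\le\deg F_1<\cdots<\deg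 F_r<\deg F$; put $F_{r+1}=F$, $C_0=0$, $C_i=v(F_i(\theta))/\deg F_i$ for $1\le i\le r+1$ (so $C_{r+1}=\infty$). $[F_1,\dots,F_r]$ is an Okutsu frame of $F$ if for all $0\le i\le r$ one has $C_i<C_{i+1}$ and every monic $g\in\mathcal{O}[x]$ of positive degree with $\deg g<\deg F_{i+1}$ satisfies $v(g(\theta))/\deg g\le C_i$. The length $r$ and the constants $C_i(F):=C_i$ do not depend on the choice of the Okutsu frame of $F$. *)

(* Defs.v *)
From HB Require Import structures.
From mathcomp Require Import all_boot all_order all_algebra finmap.
From mathcomp Require Import boolp constructive_ereal.
From mathcomp Require Import ring_quotient generic_quotient.
(* Its notations clash with those of constructive_ereal. *)
From mathcomp Require Import -(notations) monalg.

Set Implicit Arguments.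
Unset Strict Implicit.
Unset Printing Implicit Defensive.

Import Order.TTheory GRing.Theory Num.Theory.

Local Open Scope ring_scope.

Notation "x %:F" := (@FracField.tofrac _ x) : ring_scope.

(* The group algebra R[A] of an additive group A: [monalg] only multiplies   *)
(* over monoids without non-trivial units, which excludes A = rat.           *)
Definition galg (A : zmodType) (R : comNzRingType) : Type := monalg.malg A R.

Section GroupAlgebra.
Variables (A : zmodType) (R : comNzRingType).
HB.instance Definition _ := GRing.Zmodule.copy (galg A R) (monalg.malg A R).
Implicit Types (g : galg A R) (k : A).

Definition gmono k (c : R) : galg A R := mkmalgU k c.
Definition gcoef k g : R := mcoeff k g.
Definition gsupp g : {fset A} := msupp g.

Definition gone : galg A R := gmono 0 1.
Definition gmul g1 g2 : galg A R :=
  \sum_(k1 <- gsupp g1) \sum_(k2 <- gsupp g2)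
    gmono (k1 + k2) (gcoef k1 g1 * gcoef k2 g2).

HB.instance Definition _ k := GRing.isZmodMorphism.Build (galg A R) R (gcoef k)
  (@mcoeff_is_additive A R k).
HB.instance Definition _ k := GRing.isZmodMorphism.Build R (galg A R) (gmono k)
  (@monalgU_is_additive A R k).

Lemma galgP g1 g2 : (forall k, gcoef k g1 = gcoef k g2) <-> g1 = g2.
Proof. exact: malgP. Qed.

Lemma gcoef_mono k c k' : gcoef k' (gmono k c) = c *+ (k == k').
Proof. exact: mcoeffU. Qed.

Lemma galgEw g (d : {fset A}) : (gsupp g `<=` d)%fset ->
  g = \sum_(k <- d) gmono k (gcoef k g).
Proof. exact: monalgEw. Qed.

Lemma galgE g : g = \sum_(k <- gsupp g) gmono k (gcoef k g).
Proof. exact: monalgE. Qed.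

Lemma gcoef_mul k g1 g2 :
  gcoef k (gmul g1 g2) = \sum_(k1 <- gsupp g1) gcoef k1 g1 * gcoef (k - k1) g2.
Proof.
rewrite raddf_sum; apply: eq_bigr => k1 _ /=.
rewrite raddf_sum /= [in RHS](galgE g2) raddf_sum mulr_sumr.
apply: eq_bigr => k2 _ /=.
by rewrite !gcoef_mono mulrnAr eq_sym [k2 == _]eq_sym subr_eq addrC.
Qed.

Lemma gmulC : commutative gmul.
Proof.
move=> g1 g2; rewrite /gmul exchange_big /=; apply: eq_bigr => k1 _.
by apply: eq_bigr => k2 _; rewrite addrC mulrC.
Qed.

Lemma gcoef_mulw k g1 g2 (d : {fset A}) : (gsupp g1 `<=` d)%fset ->
  gcoef k (gmul g1 g2) = \sum_(k1 <- d) gcoef k1 g1 * gcoef (k - k1) g2.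
Proof.
move=> le; rewrite gcoef_mul (big_fset_incl _ le) // => k1 _ /mcoeff_outdom.
by rewrite /gcoef => ->; rewrite mul0r.
Qed.

Lemma gmulDl : left_distributive gmul +%R.
Proof.
move=> g1 g2 g; apply/galgP => k; rewrite raddfD /=.
rewrite (gcoef_mulw _ _ (msuppD_le _ _)) (gcoef_mulw _ _ (fsubsetUl _ (gsupp g2))).
rewrite (gcoef_mulw _ _ (fsubsetUr (gsupp g1) _)) -big_split /=.
by apply: eq_bigr => k1 _; rewrite -mulrDl raddfD.
Qed.

Lemma gmulDr : right_distributive gmul +%R.
Proof. by move=> g g1 g2; rewrite !(gmulC g) gmulDl. Qed.

Lemma gmul0g : left_zero 0 gmul.
Proof. by move=> g; rewrite /gmul /gsupp msupp0 big_seq_fset0. Qed.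

Lemma gmulg0 : right_zero 0 gmul.
Proof. by move=> g; rewrite gmulC gmul0g. Qed.

Lemma gmulUU k1 k2 c1 c2 :
  gmul (gmono k1 c1) (gmono k2 c2) = gmono (k1 + k2) (c1 * c2).
Proof.
apply/galgP => k; rewrite (gcoef_mulw _ _ msuppU_le) big_seq_fset1.
by rewrite !gcoef_mono eqxx mulrnAr eq_sym subr_eq addrC eq_sym.
Qed.

Lemma gmul1g : left_id gone gmul.
Proof.
move=> g; apply/galgP => k; rewrite (gcoef_mulw _ _ msuppU_le) big_seq_fset1.
by rewrite gcoef_mono eqxx mul1r subr0.
Qed.

Lemma gmulA : associative gmul.
Proof.
have suml (I : Type) (s : seq I) (F : I -> galg A R) g :
    gmul (\sum_(i <- s) F i) g = \sum_(i <- s) gmul (F i) g.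
  by apply: (big_morph (gmul^~ g)) => [x y|]; rewrite ?gmulDl ?gmul0g.
have sumr (I : Type) (s : seq I) (F : I -> galg A R) g :
    gmul g (\sum_(i <- s) F i) = \sum_(i <- s) gmul g (F i).
  by apply: (big_morph (gmul g)) => [x y|]; rewrite ?gmulDr ?gmulg0.
move=> x y z; rewrite [x]galgE !suml; apply: eq_bigr => i _.
rewrite [y]galgE sumr !suml sumr; apply: eq_bigr => j _.
rewrite [z]galgE !sumr; apply: eq_bigr => k _.
by rewrite !gmulUU addrA mulrA.
Qed.

Lemma gone_neq0 : gone != 0.
Proof.
apply/eqP => /galgP /(_ 0)/eqP; rewrite gcoef_mono eqxx raddf0.
exact/negP/oner_neq0.
Qed.

HB.instance Definition _ := GRing.Zmodule_isComNzRing.Build (galg A R)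
  gmulA gmulC gmul1g gmulDl gone_neq0.

End GroupAlgebra.

(* Valuations are additive, with values in Q and +oo at 0. *)
Record valuation (L : fieldType) := Valuation {
  vfun :> L -> \bar rat;
  vfun0 : vfun 0 = +oo%E;
  vfun_fin_num : forall x, x != 0 -> vfun x \is a fin_num;
  vfunM : forall x y, vfun (x * y) = (vfun x + vfun y)%E;
  vfunD : forall x y, (Order.min (vfun x) (vfun y) <= vfun (x + y)%R)%E
}.

Section ValuationTheory.
Variables (L : fieldType) (v : valuation L).

Lemma vfun_neqNy x : v x != -oo%E.
Proof.
have [->|x0] := eqVneq x 0; first by rewrite vfun0.
by have := vfun_fin_num v x0; rewrite fin_numE => /andP[].
Qed.

Lemma vfun1 : v 1 = 0%E.
Proof.
have := vfunM v 1 1; have := vfun_fin_num v (oner_neq0 L); rewrite mulr1.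
case: (v 1) => [r _ [] /eqP| |] //.
by rewrite -subr_eq0 opprD addNKr oppr_eq0 => /eqP ->.
Qed.

Lemma vfunN x : v (- x) = v x.
Proof.
have vN1 : v (-1) = 0%E.
  have : v (-1 * -1) = 0%E by rewrite mulrNN mulr1 vfun1.
  rewrite vfunM; have := vfun_fin_num v (_ : -1 != 0).
  rewrite oppr_eq0 oner_eq0 => /(_ isT).
  case: (v (-1)) => [r _ [] /eqP| |] //.
  by rewrite -mulr2n mulrn_eq0 => /eqP ->.
by rewrite -mulN1r vfunM vN1 add0e.
Qed.

Lemma vfun_ge_add (a : \bar rat) x y :
  (a <= v x -> a <= v y -> a <= v (x + y)%R)%E.
Proof. by move=> ax ay; apply: le_trans (vfunD v x y); rewrite le_min ax. Qed.

Lemma vfun_gt_add (a : \bar rat) x y : (a < v x -> a < v y -> a < v (x + y)%R)%E.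
Proof. by move=> ax ay; apply: lt_le_trans (vfunD v x y); rewrite lt_min ax. Qed.

End ValuationTheory.

(* Gr(mu) = (+)_a P_a / P_a^+ is built as the quotient of (+)_a P_a by        *)
(* (+)_a P_a^+. The degree a ranges over all of rat: when a is not a value of *)
(* mu, P_a = P_a^+ and the component vanishes.                                *)
Section GradedAlgebra.
Variables (K : fieldType) (mu : valuation {fraction {poly K}}).

Definition rees_pred : {pred galg rat {poly K}} :=
  fun f => `[< forall a : rat, (a%:E <= mu (gcoef a f)%:F)%E >].

Fact rees_subring_closed : subring_closed rees_pred.
Proof.
split.
- apply/asboolP => a; rewrite gcoef_mono; case: eqVneq => [<-|_].
    by rewrite mulr1n tofrac1 vfun1.
  by rewrite mulr0n tofrac0 vfun0 leey.
- move=> f g /asboolP Pf /asboolP Pg; apply/asboolP => a.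
  by rewrite raddfB tofracB; apply: vfun_ge_add; rewrite ?vfunN.
- move=> f g /asboolP Pf /asboolP Pg; apply/asboolP => a.
  rewrite gcoef_mul; elim/big_ind: _ => [|x y|k _].
  + by rewrite tofrac0 vfun0 leey.
  + by rewrite tofracD; apply: vfun_ge_add.
  rewrite tofracM vfunM -[X in X%:E](subrKC k) EFinD.
  exact: leeD (Pf k) (Pg _).
Qed.

HB.instance Definition _ :=
  GRing.isSubringClosed.Build (galg rat {poly K}) rees_pred rees_subring_closed.

Record rees : Type := Rees { rees_val :> galg rat {poly K}; _ : rees_val \in rees_pred }.
HB.instance Definition _ := [isSub for rees_val].
HB.instance Definition _ := [Choice of rees by <:].
HB.instance Definition _ := [SubChoice_isSubComNzRing of rees by <:].

Definition gr_ideal : {pred rees} :=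
  fun f => `[< forall a : rat, (a%:E < mu (gcoef a (val f))%:F)%E >].

Fact gr_ideal_zmod_closed : zmod_closed gr_ideal.
Proof.
split=> [|f g /asboolP Pf /asboolP Pg]; apply/asboolP => a.
  by rewrite (rmorph0 val) raddf0 tofrac0 vfun0 ltey.
by rewrite (rmorphB val) raddfB tofracB; apply: vfun_gt_add; rewrite ?vfunN.
Qed.

Fact gr_ideal_proper :
  1 \notin gr_ideal /\ forall a, {in gr_ideal, forall u, a * u \in gr_ideal}.
Proof.
split=> [|f g /asboolP Pg].
  apply/negP => /asboolP /(_ 0).
  by rewrite rmorph1 gcoef_mono eqxx mulr1n tofrac1 vfun1 ltxx.
have /asboolP Pf := valP f.
apply/asboolP => a; rewrite rmorphM /= gcoef_mul; elim/big_ind: _ => [|x y|k _].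
- by rewrite tofrac0 vfun0 ltey.
- by rewrite tofracD; apply: vfun_gt_add.
rewrite tofracM vfunM -[X in X%:E](subrKC k) EFinD.
by apply: lee_ltD; rewrite ?Pf ?Pg.
Qed.

HB.instance Definition _ := GRing.isZmodClosed.Build rees gr_ideal gr_ideal_zmod_closed.
HB.instance Definition _ := isProperIdeal.Build rees gr_ideal gr_ideal_proper.

End GradedAlgebra.

Notation Gr mu := {ideal_quot (@gr_ideal _ mu)}.

Local Open Scope quotient_scope.

Section KeyPolynomials.
Variables (K : fieldType) (mu : valuation {fraction {poly K}}).
Implicit Types (g h phi : {poly K}).

Fact initial_subproof g : gmono (fine (mu g%:F)) g \in rees_pred mu.
Proof.
apply/asboolP => a; rewrite gcoef_mono; case: eqVneq => [<-|_]; last first.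
  by rewrite mulr0n tofrac0 vfun0 leey.
rewrite mulr1n; have [->|g0] := eqVneq g 0; first by rewrite tofrac0 vfun0 leey.
by rewrite fineK // vfun_fin_num // tofrac_eq0.
Qed.

Definition initial g : Gr mu := \pi_(Gr mu) (Rees (initial_subproof g)).

(* The degree fine (mu 0) = 0 used for g = 0 is immaterial. *)
Lemma initial0 : initial 0 = 0.
Proof.
rewrite /initial -[RHS](rmorph0 (\pi_(Gr mu))); congr (\pi _); apply/val_inj.
by rewrite (rmorph0 val) /= raddf0.
Qed.

Definition mu_dvd h g : Prop := exists c : Gr mu, initial g = initial h * c.

Definition principal_ideal (R : comNzRingType) (a : R) : {pred R} :=
  fun b => `[< exists c, b = a * c >].

Definition deg (F : fieldType) (p : {poly F}) : nat := (size p).-1.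

Definition key_poly phi : Prop :=
  [/\ phi \is monic,
      (0 < deg phi)%N,
      initial phi != 0,
      idealr_closed (principal_ideal (initial phi)) /\
      prime_idealr_closed (principal_ideal (initial phi)) &
      forall g, g != 0 -> (deg g < deg phi)%N -> ~ mu_dvd phi g].

End KeyPolynomials.

Section MacLaneChains.
Variables (K : fieldType) (v : valuation K).
Implicit Types (mu nu : valuation {fraction {poly K}}).

(* v(K^* ) = Z *)
Definition normalized_discrete : Prop :=
  forall q : \bar rat,
    (exists2 x : K, x != 0 & v x = q) <-> (exists n : int, q = (n%:~R)%:E).

(* The set V: valuations of K(x) extending v, non-negative at x, with value   *)
(* group e * Z for some e > 0.                                                *)
Definition in_V mu : Prop :=
  [/\ forall a : K, mu (a%:P)%:F = v a,
      (0 <= mu 'X%:F)%E &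
      exists2 e : rat, 0 < e & forall q : \bar rat,
        (exists2 f, f != 0 & mu f = q) <-> (exists n : int, q = (n%:~R * e)%:E)].

Definition is_gauss mu : Prop :=
  in_V mu /\
  forall p : {poly K}, mu p%:F = \big[Order.min/+oo%E]_(s < size p) v p`_s.

(* nu = [mu; (phi, lam)]; a valuation of K(x) is determined on K[x]. *)
Definition is_augmentation mu (phi : {poly K}) (lam : rat) nu : Prop :=
  in_V nu /\
  forall n (g : 'I_n -> {poly K}),
    (forall s, (size (g s) < size phi)%N) ->
    nu (\sum_(s < n) g s * phi ^+ s)%:F =
      \big[Order.min/+oo%E]_(s < n) (mu (g s * phi ^+ s)%:F + (s%:R * lam)%:E)%E.

(* Indexing: the valuations are mu_0, ..., mu_r and the pairs (phi_i, lam_i)  *)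
(* have 1 <= i <= r; the values of the sequences elsewhere are irrelevant.    *)
Definition MacLane_chain (r : nat) (mus : nat -> valuation {fraction {poly K}})
    (phi : nat -> {poly K}) (lam : nat -> rat) : Prop :=
  is_gauss (mus 0%N) /\
  forall i, (i < r)%N ->
    [/\ key_poly (mus i) (phi i.+1), 0 < lam i.+1 &
        is_augmentation (mus i) (phi i.+1) (lam i.+1) (mus i.+1)].

Definition inductive_valuation mu : Prop :=
  exists r mus phi lam, MacLane_chain r mus phi lam /\ mus r = mu.

Definition optimal_MacLane_chain mu r mus phi lam : Prop :=
  [/\ MacLane_chain r mus phi lam, mus r = mu &
      forall i, (0 < i < r)%N -> (deg (phi i) < deg (phi i.+1))%N].

(* The constants C_i(mu), read off an optimal MacLane chain of mu. *)
Definition chain_const (mus : nat -> valuation {fraction {poly K}})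
    (phi : nat -> {poly K}) (i : nat) : \bar rat :=
  (mus i (phi i)%:F * ((deg (phi i))%:R^-1)%:E)%E.

(* Strength only depends on mu; r and phi come from an optimal chain of mu. *)
Definition strong_key_poly mu (r : nat) (phi : nat -> {poly K}) (F : {poly K}) :=
  key_poly mu F /\ (r = 0%N \/ (deg (phi r) < deg F)%N).

End MacLaneChains.

Definition valring (L : fieldType) (v : valuation L) : {pred L} :=
  fun a => (0 <= v a)%E.

Section Completion.
Variables (K : fieldType) (v : valuation K).
Variables (Kv : fieldType) (w : valuation Kv) (iota : {rmorphism K -> Kv}).

Definition is_completion : Prop :=
  [/\ forall a, w (iota a) = v a,
      forall (x : Kv) (c : rat), exists a, (c%:E < w (x - iota a)%R)%E &
      forall u : nat -> Kv,
        (forall c : rat, exists N, forall m n, (N <= m)%N -> (N <= n)%N ->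
           (c%:E < w (u m - u n)%R)%E) ->
        exists x, forall c : rat, exists N, forall n, (N <= n)%N ->
          (c%:E < w (u n - x)%R)%E].

(* Since Kv is complete, w has exactly one extension vbar to Kbar. *)
Definition is_closure (Kbar : closedFieldType) (vbar : valuation Kbar)
    (j : {rmorphism Kv -> Kbar}) : Prop :=
  (forall z, algebraicOver j z) /\ (forall x, vbar (j x) = w x).

End Completion.

Section OkutsuFrames.
Variables (K : fieldType) (v : valuation K).
Variables (Kv : fieldType) (w : valuation Kv) (iota : {rmorphism K -> Kv}).
Variables (Kbar : closedFieldType) (vbar : valuation Kbar).
Variable (j : {rmorphism Kv -> Kbar}).

Definition prime_poly (F : {poly Kv}) : Prop :=
  [/\ F \is monic, F \is a polyOver (valring w) & irreducible_poly F].

(* v(g(theta)) / deg g *)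
Definition slope (theta : Kbar) (g : {poly Kv}) : \bar rat :=
  (vbar (map_poly j g).[theta] * ((deg g)%:R^-1)%:E)%E.

(* F_1, ..., F_r, F_{r+1} = F, for indices 1 <= i <= r + 1. *)
Definition frame_poly r (Fs : nat -> {poly K}) (F : {poly Kv}) i : {poly Kv} :=
  if i == r.+1 then F else map_poly iota (Fs i).

Definition okutsu_const r Fs F theta i : \bar rat :=
  if i == 0%N then 0%E else slope theta (frame_poly r Fs F i).

Definition okutsu_frame r (Fs : nat -> {poly K}) (F : {poly Kv}) theta : Prop :=
  [/\ prime_poly F /\ root (map_poly j F) theta,
      forall i, (0 < i <= r)%N ->
        Fs i \is monic /\ Fs i \is a polyOver (valring v),
      forall i, (0 < i <= r)%N ->
        (0 < deg (Fs i))%N /\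
        (deg (frame_poly r Fs F i) < deg (frame_poly r Fs F i.+1))%N &
      forall i, (i <= r)%N ->
        (okutsu_const r Fs F theta i < okutsu_const r Fs F theta i.+1)%E /\
        forall g : {poly K}, g \is monic -> g \is a polyOver (valring v) ->
          (0 < deg g < deg (frame_poly r Fs F i.+1))%N ->
          (slope theta (map_poly iota g) <= okutsu_const r Fs F theta i)%E].

End OkutsuFrames.

(* Main.v *)
Require Import Defs.
From HB Require Import structures.
From mathcomp Require Import all_boot all_order all_algebra.
From mathcomp Require Import boolp constructive_ereal.
From mathcomp Require Import ring_quotient generic_quotient.
From mathcomp Require Import zify lra ring.

Set Implicit Arguments.
Unset Strict Implicit.
Unset Printing Implicit Defensive.

Import Order.TTheory GRing.Theory Num.Theory.

Local Open Scope ring_scope.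

(* The completeness of [Kv] enters only through the density of [K]. Let [theta]
   be a root of [F] and [N g := vbar g(theta)], so that [N F = +oo].

   Put [phi_0 = x]. A key polynomial [F] for [mu_r] has, for every [i <= r], a
   phi_i-expansion with leading term [phi_i ^ n] and [mu_i F = mu_i (phi_i ^ n)].
   If [N >= mu_i] on polynomials of degree less than [deg phi_i] and
   [N phi_i < mu_i phi_i], then [phi_i ^ n] strictly dominates the expansion of
   [F] for [N], so [N F] would be finite; hence [N >= mu_i] by induction on [i].
   Since [N phi_(i+1) > mu_i phi_(i+1)] (with [phi_(r+1) = F]), the fact that
   [phi_(i+1)] is key for [mu_i] forces [N = mu_i] in degree less than
   [deg phi_(i+1)]. The Okutsu conditions become statements on the [mu_i]: monic
   [g] satisfy [mu_i g <= deg g * C_i], and [C_(i+1) = C_i + lam_(i+1) / deg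
   phi_(i+1)]. The same bound shows that [F] is irreducible over [Kv]. *)

(** * Elementary calculus of valuations *)

Section ValuationComplements.
Variables (L : fieldType) (u : valuation L).
Implicit Types (x y : L) (r : rat).

Lemma vfun_fineK x : x != 0 -> (fine (u x))%:E = u x.
Proof. by move=> /(vfun_fin_num u)/fineK. Qed.

Lemma vfun_eqy x : (u x == +oo)%E = (x == 0).
Proof.
have [->|x0] := eqVneq x 0; first by rewrite vfun0 eqxx.
by rewrite -vfun_fineK.
Qed.

Lemma vfun_lty x : (u x < +oo)%E = (x != 0).
Proof. by rewrite lt_neqAle leey andbT vfun_eqy. Qed.

Lemma vfunBC x y : u (x - y) = u (y - x).
Proof. by rewrite -opprB vfunN. Qed.

Lemma vfunD_ltE x y : (u x < u y)%E -> u (x + y) = u x.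
Proof.
move=> xy; apply/eqP; rewrite eq_le [(u x <= _)%E]vfun_ge_add ?(ltW xy) // andbT.
rewrite leNgt; apply/negP => ltx.
have : (u x < u ((x + y) - y)%R)%E by apply: vfun_gt_add; rewrite ?vfunN.
by rewrite addrK ltxx.
Qed.

Lemma vfun_ltB_eq x y : (u x < u (x - y)%R)%E -> u y = u x.
Proof.
rewrite vfunBC => lt.
by rewrite -[y in LHS](subrK x) addrC vfunD_ltE.
Qed.

Lemma lte_vfunM2l z x y : z != 0 -> (u x < u y)%E -> (u (z * x)%R < u (z * y)%R)%E.
Proof. by move=> z0; rewrite !vfunM -(vfun_fineK z0) lteD2lE. Qed.

Lemma vfunX x r n : u x = r%:E -> u (x ^+ n) = (n%:R * r)%:E.
Proof.
move=> xr; elim: n => [|n IHn]; first by rewrite vfun1 mul0r.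
by rewrite exprS vfunM IHn xr -EFinD -natr1; congr EFin; ring.
Qed.

Lemma vfunX_ge x r n : (r%:E <= u x -> (n%:R * r)%:E <= u (x ^+ n)%R)%E.
Proof.
move=> xr; elim: n => [|n IHn]; first by rewrite vfun1 mul0r.
rewrite exprS vfunM; have -> : n.+1%:R * r = r + n%:R * r by rewrite -natr1; ring.
by rewrite EFinD leeD.
Qed.

Lemma eq_vfunX x y n : u x = u y -> u (x ^+ n) = u (y ^+ n).
Proof. by move=> xy; elim: n => // n IHn; rewrite !exprS !vfunM xy IHn. Qed.

End ValuationComplements.

(** * Division by powers of a monic polynomial *)

Section PowerDivision.
Variables (K : fieldType) (phi : {poly K}).
Hypothesis phi_monic : phi \is monic.

Lemma leq_deg_monic (p : {poly K}) : (size p <= deg phi)%N = (size p < size phi)%N.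
Proof. by rewrite -ltnS prednK // lt0n size_poly_eq0 monic_neq0. Qed.

Lemma size_monicX n : size (phi ^+ n) = (n * deg phi).+1.
Proof.
have := size_exp phi n; rewrite mulnC /deg => <-.
by rewrite prednK // lt0n size_poly_eq0 expf_neq0 // monic_neq0.
Qed.

Lemma size_modpX n (p : {poly K}) : (size (p %% phi ^+ n)%R <= n * deg phi)%N.
Proof. by rewrite -ltnS -size_monicX ltn_modp expf_neq0 // monic_neq0. Qed.

Lemma size_divpX n (p : {poly K}) : (size p <= n.+1 * deg phi)%N ->
  (size (p %/ phi ^+ n)%R < size phi)%N.
Proof.
have phi0 : (0 < size phi)%N by rewrite lt0n size_poly_eq0 monic_neq0.
rewrite size_divp ?expf_neq0 ?monic_neq0 // size_monicX mulSn addnC -leq_subLR /deg /=.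
by case: (size phi) phi0.
Qed.

(** Only the leading term of the [phi]-expansion is split off; the bound on [R] confines the
    remainder to powers below [phi ^+ n]. *)
Lemma monic_expansion (g : {poly K}) : (1 < size phi)%N -> g \is monic ->
  exists n (a R : {poly K}), [/\ g = a * phi ^+ n + R, a \is monic,
    (size a < size phi)%N, (size R <= n * deg phi)%N &
    deg g = (deg a + n * deg phi)%N].
Proof.
move=> s1 gm; have g0 := monic_neq0 gm.
have sg : (0 < size g)%N by rewrite size_poly_gt0.
have d0 : (0 < deg phi)%N by rewrite /deg -subn1 subn_gt0.
pose n := (deg g %/ deg phi)%N.
have sgn : (size g <= n.+1 * deg phi)%N by rewrite -(prednK sg) -/(deg g) /n ltn_ceil.
pose a : {poly K} := g %/ phi ^+ n; pose R : {poly K} := g %% phi ^+ n.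
have defg : g = a * phi ^+ n + R by apply: divp_eq.
have sa : (size a < size phi)%N by apply: size_divpX.
have sR : (size R <= n * deg phi)%N by apply: size_modpX.
have sRg : (size R < size g)%N.
  by apply: leq_ltn_trans sR _; rewrite -(prednK sg) ltnS leq_divM.
have a0 : a != 0.
  by apply: contraTneq sRg => a0; rewrite defg a0 mul0r add0r ltnn.
have sRa : (size R < size (a * phi ^+ n)%R)%N.
  rewrite size_Mmonic ?monic_exp // size_monicX addnS /=.
  apply: leq_ltn_trans sR _.
  by rewrite -[X in (X < _)%N]add0n ltn_add2r size_poly_gt0.
exists n, a, R; split=> //.
  by move: gm; rewrite !monicE defg lead_coefDl // lead_coef_Mmonic // monic_exp.
rewrite /deg defg size_polyDl // size_Mmonic ?monic_exp // size_monicX.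
by rewrite addnS /=; move: a0; rewrite -size_poly_gt0; case: (size a).
Qed.

End PowerDivision.

(** * Initial forms and minimality of key polynomials *)

Section InitialForms.
Variables (K : fieldType) (mu : valuation {fraction {poly K}}).
Implicit Types a b c g h phi : {poly K}.

Lemma initialM g h : initial mu (g * h) = initial mu g * initial mu h.
Proof.
have [->|g0] := eqVneq g 0; first by rewrite mul0r initial0 mul0r.
have [->|h0] := eqVneq h 0; first by rewrite mulr0 initial0 mulr0.
rewrite /initial -[RHS]rmorphM; congr (\pi_(Gr mu) _)%qT; apply/val_inj.
rewrite [RHS]rmorphM /= [RHS]gmulUU tofracM vfunM fineD //.
all: by rewrite vfun_fin_num ?tofrac_eq0.
Qed.

(** The strict ultrametric inequality puts [h] in the same degree as [g], where the difference
    vanishes. *)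
Lemma initial_eq g h : (mu g%:F < mu (g - h)%:F)%E -> initial mu g = initial mu h.
Proof.
rewrite tofracB => lt; have mugh := vfun_ltB_eq lt.
have g0 : g%:F != 0 by rewrite -(vfun_lty mu); apply: lt_le_trans lt (leey _).
apply/eqP; rewrite /initial -Quotient.idealrBE; apply/asboolP => a.
rewrite rmorphB /= raddfB /= !gcoef_mono mugh.
case: eqVneq => [<-|_]; last by rewrite !mulr0n subr0 tofrac0 vfun0 ltey.
by rewrite !mulr1n tofracB fineK ?vfun_fin_num.
Qed.

Lemma key_poly_monic phi : key_poly mu phi -> phi \is monic.
Proof. by case. Qed.

Lemma key_poly_size phi : key_poly mu phi -> (1 < size phi)%N.
Proof. by case=> _; rewrite /deg; case: (size phi) => [|[]]. Qed.

(* If [mu (a * b - c * phi) > mu (a * b)], then [H(a) * H(b)] is a multiple of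
   [H(phi)], so the primality of [H(phi)] contradicts its minimality. *)
Lemma key_poly_mulP phi a b c : key_poly mu phi -> a != 0 -> b != 0 ->
    (size a < size phi)%N -> (size b < size phi)%N ->
  (mu (a * b - c * phi)%:F <= mu (a * b)%:F)%E.
Proof.
move=> kphi a0 b0 sa sb; rewrite leNgt; apply/negP => /initial_eq.
rewrite !initialM => E; have := key_poly_size kphi.
case: kphi => _ _ _ [_ prm] ndvd s1.
have degP (p : {poly K}) : p != 0 -> (size p < size phi)%N -> (deg p < deg phi)%N.
  rewrite -size_poly_gt0 /deg; move: (size p) (size phi) s1; lia.
have /prm : initial mu a * initial mu b \in principal_ideal (initial mu phi).
  by apply/asboolP; exists (initial mu c); rewrite E mulrC.
by case/orP=> /asboolP; [apply: (ndvd a a0) | apply: (ndvd b b0)]; apply: degP.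
Qed.

End InitialForms.

(** * Expansions governed by their leading term: inverses and proportionality *)

Section Augmentations.
Variables (K : fieldType).
Implicit Types (mu nu : valuation {fraction {poly K}}) (phi F R a b g : {poly K}).

(* The two properties shared by (mu_0, x) and by all pairs (mu_i, phi_i) of a
   chain: [mu] is the minimum over the terms of phi-expansions, and, in the
   product of two polynomials of degree less than [deg phi], the multiple of
   [phi] is mu-negligible. *)
Definition defining_poly mu phi : Prop :=
  [/\ phi \is monic, (1 < size phi)%N,
      forall n a R, (size a < size phi)%N -> (size R <= n * deg phi)%N ->
        (mu (a * phi ^+ n + R)%:F <= mu (a * phi ^+ n)%:F)%E &
      forall a b, a != 0 -> b != 0 ->
        (size a < size phi)%N -> (size b < size phi)%N ->
        (mu (a * b)%:F < mu ((a * b) %/ phi * phi)%:F)%E].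

(** For monic [F] the equality of degrees already forces the leading term [phi ^+ n] in the
    [phi]-expansion. *)
Definition proportional mu phi F : Prop :=
  exists2 n, deg F = (n * deg phi)%N & mu F%:F = mu (phi ^+ n)%:F.

Section DefiningPoly.
Variables (mu : valuation {fraction {poly K}}) (phi : {poly K}).
Hypothesis dphi : defining_poly mu phi.

Let phi_monic : phi \is monic. Proof. by case: dphi. Qed.
Let phi_size : (1 < size phi)%N. Proof. by case: dphi. Qed.
Let phi0 : phi != 0. Proof. exact: monic_neq0. Qed.

Lemma defining_modP a b : a != 0 -> b != 0 ->
    (size a < size phi)%N -> (size b < size phi)%N ->
  mu ((a * b) %% phi)%:F = mu (a * b)%:F.
Proof.
move=> a0 b0 sa sb; case: dphi => _ _ _ /(_ a b a0 b0 sa sb) lt.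
apply: vfun_ltB_eq; rewrite -tofracB [X in X - _](divp_eq _ phi).
by rewrite addrK.
Qed.

(** A non-constant common divisor [g] would give [phi = k * g] with both factors of smaller degree;
    the remainder of [k * g] is then zero, yet has a finite value by [defining_modP]. *)
Lemma defining_coprime a : a != 0 -> (size a < size phi)%N -> coprimep a phi.
Proof.
move=> a0 sa; rewrite /coprimep; apply/negPn/negP => sg.
have g0 : gcdp a phi != 0 by rewrite gcdp_eq0 negb_and a0.
have /divpK def : gcdp a phi %| phi by apply: dvdp_gcdr.
set g := gcdp a phi in sg g0 def; set k := phi %/ g in def.
have k0 : k != 0 by apply: contraNneq phi0 => k0; rewrite -def k0 mul0r.
have sg1 : (1 < size g)%N.
  by move: g0; rewrite -size_poly_gt0; case: (size g) sg => [|[]].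
have sgphi : (size g < size phi)%N.
  by apply: leq_ltn_trans sa; apply: dvdp_leq; rewrite // dvdp_gcdl.
have skphi : (size k < size phi)%N.
  rewrite -def size_mul //; case: (size g) sg1 => [|[|m]] // _.
  by rewrite addnS addnS ltnS leq_addr.
have := defining_modP k0 g0 skphi sgphi; rewrite def modpp.
by move/esym/eqP; rewrite tofrac0 vfun0 vfun_eqy tofrac_eq0 (negPf phi0).
Qed.

(** Bezout, with the cofactor of [a] reduced modulo [phi]: the remainder of [a * b] is 1 and has the
    value of [a * b]. *)
Lemma defining_inverse a : a != 0 -> (size a < size phi)%N ->
  exists b c, [/\ b != 0, (size b < size phi)%N, a * b = 1 + c * phi &
    (mu (a * b)%:F = 0%E) /\ (0 < mu (c * phi)%:F)%E].
Proof.
move=> a0 sa; have /Bezout_eq1_coprimepP[[b d] /= E] := defining_coprime a0 sa.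
have mod1 : (a * (b %% phi)) %% phi = 1.
  rewrite modp_mul -[a * b](addrK (d * phi)) [a * b]mulrC E.
  rewrite modpD modpN modp_mull subr0 modp_small // size_poly1 //.
have b0 : b %% phi != 0.
  by apply: contra_eqN mod1 => /eqP ->; rewrite mulr0 mod0p eq_sym oner_eq0.
have sb : (size (b %% phi)%R < size phi)%N by rewrite ltn_modp.
have ab1 : mu (a * (b %% phi))%:F = 0%E.
  by rewrite -(defining_modP a0 b0 sa sb) mod1 tofrac1 vfun1.
exists (b %% phi), ((a * (b %% phi)) %/ phi); split=> //.
  by rewrite [LHS](divp_eq _ phi) mod1 addrC.
by split=> //; rewrite -ab1; case: dphi => _ _ _; apply.
Qed.

Lemma defining_lead n a R (gam : \bar rat) :
    (size a < size phi)%N -> (size R <= n * deg phi)%N ->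
  (gam <= mu (a * phi ^+ n + R)%:F ->
   gam <= mu (a * phi ^+ n)%:F /\ gam <= mu R%:F)%E.
Proof.
move=> sa sR le; have [_ _ /(_ n a R sa sR) lead _] := dphi.
have le1 := le_trans le lead; split=> //.
rewrite -[R](addKr (a * phi ^+ n)) tofracD; apply: vfun_ge_add => //.
by rewrite tofracN vfunN.
Qed.

Lemma defining_split n R (gam : \bar rat) :
    (size R <= n.+1 * deg phi)%N -> (gam <= mu R%:F)%E ->
  exists a R1, [/\ R = a * phi ^+ n + R1, (size a < size phi)%N,
    (size R1 <= n * deg phi)%N,
    (gam <= mu (a * phi ^+ n)%:F)%E & (gam <= mu R1%:F)%E].
Proof.
move=> sR; rewrite [R in mu R%:F](divp_eq R (phi ^+ n)) => le.
have sa := size_divpX phi_monic sR; have sR1 := size_modpX phi_monic n R.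
have [] := defining_lead sa sR1 le.
by exists (R %/ phi ^+ n), (R %% phi ^+ n); split=> //; apply: divp_eq.
Qed.

(* Multiplication by [b] preserves the length of phi-expansions up to
   mu-equivalence. *)
Lemma defining_mul_small n b R (gam : rat) :
    b != 0 -> (size b < size phi)%N -> (size R <= n * deg phi)%N ->
    (gam%:E <= mu (b * R)%:F)%E ->
  exists2 R' : {poly K}, (size R' <= n * deg phi)%N & (gam%:E < mu (b * R - R')%:F)%E.
Proof.
move=> b0 sb; have bF0 : b%:F != 0 by rewrite tofrac_eq0.
elim: n R => [|n IHn] R sR le.
  exists 0; rewrite ?size_poly0 // subr0.
  move: sR; rewrite mul0n leqn0 size_poly_eq0 => /eqP ->.
  by rewrite mulr0 tofrac0 vfun0 ltry.
have leR : ((gam - fine (mu b%:F))%:E <= mu R%:F)%E.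
  by move: le; rewrite tofracM vfunM EFinB leeBlDl ?vfun_fineK ?vfun_fin_num.
have [a [R1 [-> sa sR1 lea leR1]]] := defining_split sR leR.
have up x : ((gam - fine (mu b%:F))%:E <= mu x%:F)%E -> (gam%:E <= mu (b * x)%:F)%E.
  by rewrite tofracM vfunM EFinB leeBlDl ?vfun_fineK ?vfun_fin_num.
have [R1' sR1' ltR1'] := IHn R1 sR1 (up _ leR1).
have [a0|a0] := eqVneq a 0.
  exists R1'; first by apply: leq_trans sR1' _; rewrite mulSn leq_addl.
  by rewrite a0 mul0r add0r.
(* Reducing the new leading coefficient modulo [phi] keeps the length; the discarded multiple of
   [phi] has larger value. *)
exists ((a * b) %% phi * phi ^+ n + R1').
  rewrite (leq_trans (size_polyD _ _)) // geq_max; apply/andP; split.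
    rewrite (leq_trans (size_polyMleq _ _)) // size_monicX //= mulSn addnS /=.
    by rewrite leq_add2r leq_deg_monic // ltn_modp.
  by apply: leq_trans sR1' _; rewrite mulSn leq_addl.
have -> : b * (a * phi ^+ n + R1) - ((a * b) %% phi * phi ^+ n + R1') =
    (a * b) %/ phi * phi * phi ^+ n + (b * R1 - R1').
  have := divp_eq (a * b) phi; move: (_ %/ _) (_ %% _) => q r E.
  have -> : b * (a * phi ^+ n + R1) = a * b * phi ^+ n + b * R1 by ring.
  by rewrite E; ring.
rewrite tofracD; apply: vfun_gt_add => //.
apply: le_lt_trans (up _ lea) _.
rewrite mulrA [b * a]mulrC !(mulrC _ (phi ^+ n)) !(tofracM (phi ^+ n)).
apply: lte_vfunM2l; first by rewrite tofrac_eq0 expf_neq0.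
by case: dphi => _ _ _; apply.
Qed.

End DefiningPoly.

(** Write [F = a * phi ^+ n + R]. If [a] is not constant, multiplying by its inverse modulo [phi]
    makes a multiple of [F] equivalent to a polynomial with leading term [phi ^+ n], of degree below
    [deg F], against the minimality of [F]. *)
Lemma key_poly_proportional mu phi F :
  defining_poly mu phi -> key_poly mu F -> proportional mu phi F.
Proof.
move=> dphi kF; have Fm := key_poly_monic kF; have F0 := monic_neq0 Fm.
have phim : phi \is monic by case: dphi.
have s1 : (1 < size phi)%N by case: dphi.
have sF := key_poly_size kF.
have key (G b : {poly K}) : G != 0 -> (size G < size F)%N ->
    ~ (mu (b * F)%:F < mu (b * F - G)%:F)%E.
  move=> G0 sG lt; have := key_poly_mulP b kF G0 (oner_neq0 _) sG.
  rewrite size_poly1 mulr1 => /(_ sF); rewrite leNgt => /negP; apply.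
  move: lt; rewrite !tofracB => lt.
  by rewrite vfunBC (vfun_ltB_eq lt).
have [n [a [R [defF am sa sR degF]]]] := monic_expansion phim s1 Fm.
have a0 := monic_neq0 am.
have sRF : (size R < size F)%N.
  apply: leq_ltn_trans sR _.
  by rewrite -(prednK (ltnW sF)) ltnS -/(deg F) degF leq_addl.
(* Were the value of [F] smaller, [F] would share its initial form with [R], of smaller degree. *)
have muF : mu F%:F = mu (a * phi ^+ n)%:F.
  apply/eqP; rewrite eq_le {1}defF; case: (dphi) => _ _ -> //= _.
  rewrite leNgt; apply/negP => lt.
  have R0 : R != 0 by apply: contraTneq lt => R0; rewrite {1}defF R0 addr0 ltxx.
  by apply: (key R 1) => //; rewrite mul1r {2}defF addrK.
have [sa1|sa1] := leqP (size a) 1.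
  have a1 : a = 1.
    move: am; rewrite (size1_polyC sa1) monicE lead_coefC => /eqP lc.
    by rewrite lc.
  by exists n; rewrite ?muF ?a1 ?mul1r // degF a1 /deg size_poly1.
case: notF.
have [b [c [b0 sb abE [muab muc]]]] := defining_inverse dphi a0 sa.
have FF0 : F%:F != 0 by rewrite tofrac_eq0.
have bF0 : b%:F != 0 by rewrite tofrac_eq0.
have leR : (mu F%:F <= mu R%:F)%E.
  by apply: (defining_lead dphi sa sR _).2; rewrite -defF.
have mubF : ((fine (mu (b * F)%:F))%:E = mu (b * F)%:F)%E.
  by apply: vfun_fineK; rewrite tofrac_eq0 mulf_neq0.
have lebR : ((fine (mu (b * F)%:F))%:E <= mu (b * R)%:F)%E.
  by rewrite mubF !tofracM !vfunM leeD2l.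
have [R' sR' ltR'] := defining_mul_small dphi b0 sb sR lebR.
rewrite mubF in ltR'.
have sG : size (phi ^+ n + R') = (n * deg phi).+1.
  by rewrite size_polyDl size_monicX.
have G0 : phi ^+ n + R' != 0 by rewrite -size_poly_gt0 sG.
have sGF : (size (phi ^+ n + R')%R < size F)%N.
  rewrite sG -(prednK (ltnW sF)) ltnS -/(deg F) degF -[X in (X < _)%N]add0n.
  by rewrite ltn_add2r /deg -subn1 subn_gt0.
case: (key _ b G0 sGF).
have -> : b * F - (phi ^+ n + R') = c * phi * phi ^+ n + (b * R - R').
  have -> : b * F = a * b * phi ^+ n + b * R by rewrite {1}defF; ring.
  by rewrite abE; ring.
rewrite tofracD; apply: vfun_gt_add => //.
have -> : mu (b * F)%:F = mu (a * b * phi ^+ n)%:F.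
  by rewrite mulrC -mulrA -(mulrC (phi ^+ n)) mulrA !(tofracM _ b) !vfunM muF.
rewrite !(mulrC _ (phi ^+ n)) !(tofracM (phi ^+ n)).
have pF0 : (phi ^+ n)%:F != 0 by rewrite tofrac_eq0 expf_neq0 // monic_neq0.
by apply: (lte_vfunM2l pF0); rewrite muab.
Qed.

(** * Comparing [mu] with the pullback of another valuation *)

Section Comparison.
Variables (mu : valuation {fraction {poly K}}) (phi : {poly K}).
Variables (L : fieldType) (u : valuation L) (f : {rmorphism {poly K} -> L}).
Hypothesis dphi : defining_poly mu phi.
Hypothesis small : forall a, (size a < size phi)%N -> (mu a%:F <= u (f a))%E.

(** If [phi] loses at most [dlt], a term in [phi ^+ s] loses at most [s] times [dlt], and the size
    of [R] allows only [s <= n]. *)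
Lemma transfer_le (y dlt gam : rat) n R :
    0 <= dlt -> mu phi%:F = y%:E -> ((y - dlt)%:E <= u (f phi))%E ->
    (size R <= n.+1 * deg phi)%N -> (gam%:E <= mu R%:F)%E ->
  ((gam - n%:R * dlt)%:E <= u (f R))%E.
Proof.
move=> dlt0 muphi uphi; have phim : phi \is monic by case: dphi.
elim: n R => [|n IHn] R sR leR.
  rewrite mul0r subr0; apply: le_trans leR _; apply: small.
  by rewrite -leq_deg_monic // -[deg phi]mul1n.
have [a [R1 [-> sa sR1 lea leR1]]] := defining_split dphi sR leR.
rewrite rmorphD; apply: vfun_ge_add; last first.
  by apply: le_trans (IHn R1 sR1 leR1); rewrite lee_fin -natr1; nra.
rewrite (rmorphM f) (rmorphXn f) vfunM.
have muphin : mu (phi ^+ n.+1)%:F = (n.+1%:R * y)%:E.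
  by rewrite tofracXn (vfunX _ muphi).
have leu : ((gam - n.+1%:R * y)%:E <= u (f a))%E.
  apply: le_trans (small sa); move: lea; rewrite tofracM vfunM muphin EFinB.
  by rewrite leeBlDr.
have -> : gam - n.+1%:R * dlt = gam - n.+1%:R * y + n.+1%:R * (y - dlt) by ring.
by rewrite EFinD leeD // vfunX_ge.
Qed.

Lemma transfer_dominates :
  (mu phi%:F <= u (f phi))%E -> forall g, (mu g%:F <= u (f g))%E.
Proof.
move=> le g; have phim : phi \is monic by case: dphi.
have [->|g0] := eqVneq g 0; first by rewrite (rmorph0 f) (vfun0 u) leey.
have muphi : mu phi%:F = (fine (mu phi%:F))%:E.
  by rewrite vfun_fineK // tofrac_eq0 monic_neq0.
have mug : mu g%:F = (fine (mu g%:F))%:E by rewrite vfun_fineK // tofrac_eq0.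
(* With nothing lost at [phi] the length of the expansion is harmless, so the crude bound [size g]
   suffices. *)
have := @transfer_le _ 0 (fine (mu g%:F)) (size g) g (lexx 0) muphi.
rewrite subr0 mulr0 subr0 -muphi -mug; apply=> //.
have : (1 < size phi)%N by case: dphi.
rewrite /deg; case: (size phi) => [|[|m]] // _.
by rewrite (leq_trans (leqnSn _)) // leq_pmulr.
Qed.

(* Lowering the slope at [phi] makes the leading term of the phi-expansion of
   [F] strictly dominant. *)
Lemma transfer_lead (y dlt : rat) F n :
    0 < dlt -> mu phi%:F = y%:E -> u (f phi) = (y - dlt)%:E ->
    F \is monic -> deg F = (n * deg phi)%N -> mu F%:F = mu (phi ^+ n)%:F ->
  u (f F) = u (f (phi ^+ n)).
Proof.
move=> dlt0 muphi uphi Fm degF muF; have phim : phi \is monic by case: dphi.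
have sF : size F = size (phi ^+ n).
  by rewrite size_monicX // -degF prednK // size_poly_gt0 monic_neq0.
pose R := F - phi ^+ n; have defF : F = 1 * phi ^+ n + R by rewrite mul1r addrC subrK.
have sR : (size R <= n * deg phi)%N.
  have [->|R0] := eqVneq R 0; first by rewrite size_poly0.
  rewrite -ltnS -size_monicX //.
  have Fn0 : F != 0 by apply: monic_neq0.
  rewrite -(prednK (_ : 0 < size (phi ^+ n)%R)%N) ?ltnS; last first.
    by rewrite size_poly_gt0 expf_neq0 // monic_neq0.
  apply/leq_sizeP => i; rewrite leq_eqVlt => /predU1P[<-|lti].
    rewrite coefB -{1}sF -!lead_coefE (monicP Fm) (monicP (monic_exp _ phim)).
    by rewrite subrr.
  have {lti} : (size (phi ^+ n)%R <= i)%N by move: lti; case: (size _).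
  by move=> le; rewrite coefB !nth_default ?subr0 ?sF.
have muphin : mu (phi ^+ n)%:F = (n%:R * y)%:E by rewrite tofracXn (vfunX _ muphi).
have sone : (size (1%R : {poly K}) < size phi)%N by rewrite size_poly1; case: dphi.
have leR : ((n%:R * y)%:E <= mu R%:F)%E.
  by apply: (defining_lead dphi sone sR _).2; rewrite -defF muF muphin.
have uphin : u (f (phi ^+ n)) = (n%:R * (y - dlt))%:E.
  by rewrite rmorphXn (vfunX _ uphi).
rewrite defF mul1r rmorphD vfunD_ltE // uphin; clearbody R.
case: n degF muF sR leR {sF defF muphin uphin} => [|n] degF muF sR leR.
  by move: sR; rewrite mul0n leqn0 size_poly_eq0 => /eqP ->;
    rewrite (rmorph0 f) (vfun0 u) ltry.
(* The leading term loses [n.+1] times [dlt], but [R] at most [n] times. *)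
apply: lt_le_trans (transfer_le (ltW dlt0) muphi _ sR leR); last by rewrite uphi.
by rewrite lte_fin -natr1; nra.
Qed.

(** If [u] lowered the value of [phi], [transfer_lead] would make the value of [F] a multiple of
    that of [phi], hence finite. *)
Lemma root_dominates F :
    F \is monic -> (0 < deg F)%N -> proportional mu phi F -> u (f F) = +oo%E ->
  forall g, (mu g%:F <= u (f g))%E.
Proof.
move=> Fm dF [n degF muF] uF; apply: transfer_dominates.
have phim : phi \is monic by case: dphi.
have muphi : mu phi%:F = (fine (mu phi%:F))%:E.
  by rewrite vfun_fineK // tofrac_eq0 monic_neq0.
rewrite leNgt; apply/negP => lt.
have [x ux] : exists x, u (f phi) = x%:E.
  case: (u (f phi)) lt (vfun_neqNy u (f phi)) => [x||] //; first by exists x.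
  by rewrite ltNge leey.
have ltx : 0 < fine (mu phi%:F) - x by rewrite subr_gt0 -lte_fin -muphi -ux.
have uE : u (f phi) = (fine (mu phi%:F) - (fine (mu phi%:F) - x))%:E.
  by rewrite ux; congr EFin; ring.
have := transfer_lead ltx muphi uE Fm degF muF.
by rewrite uF rmorphXn (vfunX _ ux).
Qed.

End Comparison.

(** Take [g] of least degree where [u] exceeds [mu] and divide [phi] by it, with remainder [rho].
    Both [phi] and [q * g] gain value under [u] while [rho] does not, although its [mu]-value is at
    most theirs: a contradiction. *)
Lemma key_poly_rigid mu phi (L : fieldType) (u : valuation L)
    (f : {rmorphism {poly K} -> L}) :
    key_poly mu phi -> (forall c : K, u (f c%:P) = mu c%:P%:F) ->
    (forall g, (mu g%:F <= u (f g))%E) -> (mu phi%:F < u (f phi))%E ->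
  forall g, (size g < size phi)%N -> u (f g) = mu g%:F.
Proof.
move=> kphi uc le ltphi g; have [m] := ubnP (size g).
elim: m g => // m IHm g; rewrite ltnS => sgm sg.
have [sg1|sg1] := leqP (size g) 1; first by rewrite (size1_polyC sg1) uc.
have g0 : g != 0 by rewrite -size_poly_gt0 ltnW.
apply/eqP; rewrite eq_le le andbT leNgt; apply/negP => ltg.
pose q : {poly K} := phi %/ g; pose rho : {poly K} := phi %% g.
have defphi : phi = q * g + rho by apply: divp_eq.
have phi0 : phi != 0 by rewrite monic_neq0 // (key_poly_monic kphi).
have q0 : q != 0 by rewrite divp_eq0 !negb_or phi0 g0 -leqNgt ltnW.
have sq : (size q < size phi)%N.
  rewrite size_divp // ltn_subrL size_poly_gt0 phi0 andbT.
  by case: (size g) sg1 => [|[]].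
have srho : (size rho < size g)%N by rewrite ltn_modp. clearbody q rho.
have urho : u (f rho) = mu rho%:F.
  by apply: IHm; [apply: leq_trans sgm | apply: ltn_trans sg].
(* Otherwise [q * g] and [phi] would have the same initial form. *)
have lerho : (mu rho%:F <= mu (q * g)%:F)%E.
  have := key_poly_mulP 1 kphi q0 g0 sq sg; rewrite mul1r [X in _ - X]defphi.
  by rewrite opprD addrA subrr add0r tofracN vfunN.
have lerho' : (mu rho%:F <= mu phi%:F)%E.
  by rewrite defphi tofracD; apply: vfun_ge_add.
have ltqg : (mu (q * g)%:F < u (f (q * g)%R))%E.
  rewrite (rmorphM f) tofracM !vfunM.
  apply: (@lt_le_trans _ _ (mu q%:F + u (f g))%E); last exact: leeD2r.
  by rewrite lteD2lE // vfun_fin_num ?tofrac_eq0.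
have : (mu rho%:F < u (f (phi - q * g)%R))%E.
  rewrite rmorphB; apply: vfun_gt_add; rewrite ?vfunN.
    exact: le_lt_trans ltphi.
  exact: le_lt_trans ltqg.
have -> : phi - q * g = rho by rewrite defphi addrC addKr.
by rewrite urho ltxx.
Qed.

End Augmentations.

(** * The Gauss valuation *)

Section Chains.
Variables (K : fieldType) (v : valuation K).
Implicit Types (mu nu : valuation {fraction {poly K}}) (phi F a b g R : {poly K}).

Lemma gauss_le_coef mu g s : is_gauss v mu -> (mu g%:F <= v g`_s)%E.
Proof.
case=> _ ->; have [lt|le] := ltnP s (size g); last by rewrite nth_default ?vfun0 ?leey.
exact: (bigmin_le _ (Ordinal lt) (fun s : 'I_(size g) => v g`_s)).
Qed.

Lemma gaussX mu : is_gauss v mu -> mu 'X%:F = 0%E.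
Proof.
case=> _ ->; rewrite size_polyX !big_ord_recr big_ord0 /= !coefX /= vfun0 vfun1.
by rewrite minxx minEle leye_eq.
Qed.

Lemma gauss_defining mu : is_gauss v mu -> defining_poly mu 'X.
Proof.
move=> gmu; have [[muc _ _] _] := gmu; have X0 := gaussX gmu.
split=> [||n a R|a b a0 b0]; rewrite ?monicX ?size_polyX //.
  move=> sa; rewrite /deg size_polyX muln1 => sR.
  have muXn : mu ('X^n)%:F = 0%E by rewrite tofracXn (vfunX (r := 0)) // mulr0.
  rewrite (tofracM a) vfunM muXn adde0 (size1_polyC sa) muc.
  apply: le_trans (gauss_le_coef _ n gmu) _.
  by rewrite coefD coefCM coefXn eqxx mulr1 (nth_default _ sR) addr0.
move=> sa sb.
have -> : (a * b) %/ 'X = 0.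
  rewrite divp_small // size_polyX (size1_polyC sa) (size1_polyC sb).
  by rewrite -polyCM ltnS size_polyC_leq1.
rewrite mul0r tofrac0 vfun0 vfun_lty tofrac_eq0 mulf_neq0 //.
Qed.

(** * One augmentation step *)

Section Augmentation.
Variables (mu nu : valuation {fraction {poly K}}) (phi : {poly K}) (lam : rat).
Hypothesis (kphi : key_poly mu phi) (lam0 : 0 < lam).
Hypothesis aug : is_augmentation v mu phi lam nu.

Let phim : phi \is monic. Proof. exact: key_poly_monic kphi. Qed.
Let s1 : (1 < size phi)%N. Proof. exact: key_poly_size kphi. Qed.

Lemma exists_expansion n R : (size R <= n * deg phi)%N ->
  exists2 c : nat -> {poly K}, forall s, (size (c s) < size phi)%N &
    R = \sum_(s < n) c s * phi ^+ s.
Proof.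
elim: n R => [|n IHn] R sR.
  exists (fun=> 0) => [s|]; first by rewrite size_poly0 ltnW.
  by move: sR; rewrite mul0n leqn0 size_poly_eq0 big_ord0 => /eqP.
have [c sc E] := IHn _ (size_modpX phim n R).
exists (fun s => if s == n then R %/ phi ^+ n else c s) => [s|].
  by case: eqP => // _; apply: size_divpX.
rewrite big_ord_recr /= eqxx [LHS](divp_eq _ (phi ^+ n)) addrC E.
congr (_ + _); apply: eq_bigr => s _.
by rewrite ltn_eqF.
Qed.

Lemma augmentation_term n a : (size a < size phi)%N ->
  nu (a * phi ^+ n)%:F = (mu (a * phi ^+ n)%:F + (n%:R * lam)%:E)%E.
Proof.
move=> sa; pose c (s : 'I_n.+1) := if s == n :> nat then a else 0.
have sc s : (size (c s) < size phi)%N.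
  by rewrite /c; case: eqP => // _; rewrite size_poly0 ltnW.
have := aug.2 n.+1 c sc.
rewrite !big_ord_recr /= /c eqxx big1 ?add0r => [|s _]; last first.
  by rewrite /= ltn_eqF // mul0r.
move=> ->; rewrite bigmin_eq_id ?minEle ?leye_eq => [|s _]; last first.
  by rewrite /= ltn_eqF // mul0r tofrac0 vfun0.
by case: eqP => // ->.
Qed.

Lemma augmentation_small a : (size a < size phi)%N -> nu a%:F = mu a%:F.
Proof.
by move=> sa; have := augmentation_term 0 sa; rewrite expr0 mulr1 mul0r adde0.
Qed.

Lemma augmentation_key : nu phi%:F = (mu phi%:F + lam%:E)%E.
Proof.
by have := @augmentation_term 1 1; rewrite size_poly1 expr1 !mul1r; apply.
Qed.

(** The leading-term bound is the minimum formula. For products write [a * b = q * phi + d]: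
    minimality of [phi] gives [mu d <= mu (a * b) <= mu (q * phi)], and [nu] adds [lam] to the last
    value while keeping that of [d]. *)
Lemma augmentation_defining : defining_poly nu phi.
Proof.
split=> // [n a R sa sR|a b a0 b0 sa sb].
  have [c sc ->] := exists_expansion sR.
  pose d (s : 'I_n.+1) := if s == n :> nat then a else c s.
  have sd s : (size (d s) < size phi)%N by rewrite /d; case: eqP.
  have := aug.2 n.+1 d sd; rewrite big_ord_recr /= {2}/d eqxx addrC.
  rewrite (eq_bigr (fun s : 'I_n => c s * phi ^+ s)) => [->|s _]; last first.
    by rewrite /d /= ltn_eqF.
  rewrite augmentation_term //.
  have := bigmin_le +oo%E ord_max
    (fun s : 'I_n.+1 => (mu (d s * phi ^+ s)%:F + (s%:R * lam)%:E)%E).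
  by rewrite /= {2}/d eqxx.
have phi0 : phi != 0 by rewrite monic_neq0.
have key c : (mu (a * b - c * phi)%:F <= mu (a * b)%:F)%E by apply: key_poly_mulP.
pose q : {poly K} := (a * b) %/ phi; pose d : {poly K} := (a * b) %% phi.
have E : a * b = q * phi + d by apply: divp_eq.
have ab0 : (a * b)%:F != 0 by rewrite tofrac_eq0 mulf_neq0.
have sq : (size q < size phi)%N.
  rewrite /q -[phi in _ %/ phi]expr1; apply: size_divpX => //.
  apply: leq_trans (size_polyMleq _ _) _; apply: leq_trans (leq_pred _) _.
  by rewrite mul2n -addnn leq_add // leq_deg_monic.
have sd : (size d < size phi)%N by rewrite ltn_modp.
have dE : d = a * b - q * phi by rewrite E addrC addKr.
rewrite -/q; clearbody q d; have led : (mu d%:F <= mu (a * b)%:F)%E by rewrite dE.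
(* Otherwise [d] and [- q * phi] would have the same initial form, with [d] of smaller degree than
   [phi]. *)
have leq : (mu (a * b)%:F <= mu (q * phi)%:F)%E.
  rewrite leNgt; apply/negP => lt.
  have mud : mu d%:F = mu (q * phi)%:F.
    by rewrite dE tofracB vfunBC vfunD_ltE // vfunN.
  have d0 : d != 0 by apply: contraTneq lt => d0; rewrite E d0 addr0 ltxx.
  have := key_poly_mulP (- q) kphi d0 (oner_neq0 _) sd.
  rewrite size_poly1 mulr1 => /(_ s1); rewrite mulNr opprK addrC -E mud.
  by rewrite leNgt lt.
have [q0|q0] := eqVneq q 0; first by rewrite q0 mul0r tofrac0 vfun0 vfun_lty.
have ltq : (mu (q * phi)%:F < nu (q * phi)%:F)%E.
  have := augmentation_term 1 sq; rewrite expr1 mul1r => ->.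
  have qphi0 : (q * phi)%:F != 0 by rewrite tofrac_eq0 mulf_neq0.
  by rewrite -(vfun_fineK mu qphi0) -EFinD lte_fin ltrDl.
rewrite {1}E addrC tofracD; have lt : (nu d%:F < nu (q * phi)%:F)%E.
  by rewrite augmentation_small //; apply: le_lt_trans led (le_lt_trans leq ltq).
by rewrite vfunD_ltE.
Qed.

End Augmentation.

(** * Slopes and proportionality along a chain *)

Section Chain.
Variables (r : nat) (mus : nat -> valuation {fraction {poly K}}).
Variables (phi : nat -> {poly K}) (lam : nat -> rat).
Hypothesis chain : MacLane_chain v r mus phi lam.

(* Phi_0 = x makes mu_0 behave like an augmentation with phi_0 = x. *)
Definition chain_poly i : {poly K} := if i is 0%N then 'X else phi i.

(** For [0 < i <= r] this is C_i(mu) as a rational; at [i = 0] the polynomial [x] yields the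
    convention C_0 = 0. *)
Definition chain_slope i : rat :=
  fine (mus i (chain_poly i)%:F) / (deg (chain_poly i))%:R.

Lemma chain_key i : (i < r)%N -> key_poly (mus i) (phi i.+1).
Proof. by case: chain => _ /[apply] -[]. Qed.

Lemma chain_augmentation i : (i < r)%N ->
  0 < lam i.+1 /\ is_augmentation v (mus i) (phi i.+1) (lam i.+1) (mus i.+1).
Proof. by case: chain => _ /[apply] -[]. Qed.

Lemma chain_defining i : (i <= r)%N -> defining_poly (mus i) (chain_poly i).
Proof.
case: i => [|i] ir; first by apply: gauss_defining; case: chain.
have [lam0 aug] := chain_augmentation ir.
exact: augmentation_defining (chain_key ir) lam0 aug.
Qed.

Lemma chain_const_poly i c : (i <= r)%N -> mus i c%:P%:F = v c.
Proof.
case: i => [_|i ir]; first by case: chain => -[[]].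
by have [_ [[]]] := chain_augmentation ir.
Qed.

Lemma chain_poly_monic i : (i <= r)%N -> chain_poly i \is monic.
Proof. by move=> /chain_defining[]. Qed.

Lemma chain_deg_gt0 i : (i <= r)%N -> (0 < deg (chain_poly i))%N.
Proof. by move=> /chain_defining[_ s1 _ _]; rewrite /deg -subn1 subn_gt0. Qed.

Lemma chain_value i : (i <= r)%N ->
  mus i (chain_poly i)%:F = ((deg (chain_poly i))%:R * chain_slope i)%:E.
Proof.
move=> ir; rewrite /chain_slope mulrC divfK; last first.
  by rewrite pnatr_eq0 -lt0n chain_deg_gt0.
by rewrite vfun_fineK // tofrac_eq0 monic_neq0 // chain_poly_monic.
Qed.

(** By proportionality, [phi_(i+1)] has the slope of [phi_i] for [mu_i], before the augmentation
    raises it. *)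
Lemma chain_poly_value i : (i < r)%N ->
  mus i (phi i.+1)%:F = ((deg (phi i.+1))%:R * chain_slope i)%:E.
Proof.
move=> ir; have := key_poly_proportional (chain_defining (ltnW ir)) (chain_key ir).
case=> n degF ->.
by rewrite tofracXn (vfunX _ (chain_value (ltnW ir))) degF natrM mulrA.
Qed.

Lemma chain_slope0 : chain_slope 0 = 0.
Proof.
by rewrite /chain_slope gaussX ?mul0r //; case: chain.
Qed.

Lemma chain_slopeS i : (i < r)%N ->
  chain_slope i.+1 = chain_slope i + lam i.+1 / (deg (phi i.+1))%:R.
Proof.
move=> ir; have [lam0 aug] := chain_augmentation ir.
have d0 : ((deg (phi i.+1))%:R : rat) != 0.
  by rewrite pnatr_eq0 -lt0n (@chain_deg_gt0 i.+1).
rewrite {1}/chain_slope /= (augmentation_key (chain_key ir) aug) chain_poly_value //.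
by rewrite -EFinD /= mulrDl mulrAC mulfV // mul1r.
Qed.

Lemma chain_slope_lt i : (i < r)%N -> chain_slope i < chain_slope i.+1.
Proof.
move=> ir; rewrite chain_slopeS // ltrDl divr_gt0 //.
  by case: (chain_augmentation ir).
by rewrite ltr0n (@chain_deg_gt0 i.+1).
Qed.

(** The leading term [a * phi_i ^ n] bounds the value of [g]: the power has slope C_i, and the monic
    [a] obeys, by induction, the bound with C_(i-1) < C_i. For [i = 0], [a] is 1. *)
Lemma chain_bound i g : (i <= r)%N -> g \is monic ->
  (mus i g%:F <= ((deg g)%:R * chain_slope i)%:E)%E.
Proof.
elim: i g => [|i IHi] g ir gm; have [phim s1 lead _] := chain_defining ir;
  have [n [a [R [-> am sa sR degg]]]] := monic_expansion phim s1 gm;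
  apply: le_trans (lead _ _ _ sa sR) _.
all: rewrite degg natrD natrM mulrDl -mulrA EFinD tofracM vfunM; apply: leeD.
all: rewrite ?tofracXn ?(vfunX _ (chain_value ir)) //.
  have sa1 : (size a <= 1)%N by move: sa; rewrite /= size_polyX.
  move: am; rewrite (size1_polyC sa1) monicE lead_coefC => /eqP ->.
  by rewrite tofrac1 vfun1 chain_slope0 mulr0.
have [_ aug] := chain_augmentation ir.
rewrite (augmentation_small (chain_key ir) aug) //.
apply: le_trans (IHi a (ltnW ir) am) _.
by rewrite lee_fin ler_wpM2l // ltW // chain_slope_lt.
Qed.

(** Going from [mus i.+1] down to [mus i] only lowers [phi_(i+1)] by [lam i.+1], so [transfer_lead]
    gives [F] the value of a power of [phi_(i+1)], itself proportional to [phi_i]. *)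
Lemma proportional_descent i F : (i < r)%N -> F \is monic ->
    proportional (mus i.+1) (phi i.+1) F ->
  proportional (mus i) (chain_poly i) F.
Proof.
move=> ir Fm [n degF muF]; have [lam0 aug] := chain_augmentation ir.
have kphi := chain_key ir.
have [m degphi muphi] := key_poly_proportional (chain_defining (ltnW ir)) kphi.
exists (n * m)%N; first by rewrite degF degphi mulnA.
have dphi : defining_poly (mus i.+1) (phi i.+1) by apply: (@chain_defining i.+1).
pose x := (deg (phi i.+1))%:R * chain_slope i.
have mux : mus i (phi i.+1)%:F = x%:E by apply: chain_poly_value.
have muy : mus i.+1 (phi i.+1)%:F = (x + lam i.+1)%:E.
  by rewrite (augmentation_key kphi aug) mux.
have small a : (size a < size (phi i.+1))%N -> (mus i.+1 a%:F <= mus i a%:F)%E.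
  by move=> sa; rewrite (augmentation_small kphi aug).
have mux' : mus i (phi i.+1)%:F = (x + lam i.+1 - lam i.+1)%:E by rewrite addrK.
have -> : mus i F%:F = mus i (phi i.+1 ^+ n)%:F.
  exact: (transfer_lead dphi small lam0 muy mux' Fm degF muF).
rewrite mulnC exprM (tofracXn n (phi i.+1)) (tofracXn n (_ ^+ m)); exact: eq_vfunX.
Qed.

Lemma chain_proportional k F : (k <= r)%N -> F \is monic ->
    proportional (mus k) (chain_poly k) F ->
  forall i, (i <= k)%N -> proportional (mus i) (chain_poly i) F.
Proof.
elim: k => [|k IHk] kr Fm pF i; first by rewrite leqn0 => /eqP ->.
rewrite leq_eqVlt => /predU1P[-> //|]; rewrite ltnS.
by apply: IHk => //; [apply: ltnW | apply: proportional_descent].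
Qed.

(** Descent to [mu_0], where [x] has value 0, gives [F] the Gauss value 0, a lower bound for its
    coefficients. *)
Lemma chain_key_integral k F : (k <= r)%N -> key_poly (mus k) F ->
  F \is a polyOver (valring v).
Proof.
move=> kr kF; have Fm := key_poly_monic kF.
have pF := key_poly_proportional (chain_defining kr) kF.
have [n _ muF] := chain_proportional kr Fm pF (leq0n k).
have gmu : is_gauss v (mus 0%N) by case: chain.
rewrite qualifE; apply/(all_nthP 0) => s _; rewrite -[_ F`_s]/(0 <= v F`_s)%E.
apply: le_trans (gauss_le_coef F s gmu).
by rewrite muF tofracXn (vfunX (r := 0)) ?mulr0 // gaussX.
Qed.

(** * Values at a root of a key polynomial *)

Section Root.
Variables (L : fieldType) (u : valuation L) (f : {rmorphism {poly K} -> L}).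
Hypothesis u_const : forall c : K, u (f c%:P) = v c.
Variable F : {poly K}.
Hypotheses (kF : key_poly (mus r) F) (uF : u (f F) = +oo%E).

(** Below the degree of [phi_i], [mu_i] agrees with [mu_(i-1)], dominated by induction;
    [root_dominates] extends this to all [g]. *)
Lemma root_chain_le i g : (i <= r)%N -> (mus i g%:F <= u (f g))%E.
Proof.
have Fm := key_poly_monic kF.
have := key_poly_proportional (chain_defining (leqnn r)) kF.
move=> /(chain_proportional (leqnn r) Fm) pF.
elim: i g => [|i IHi] g ir;
  apply: (root_dominates (chain_defining ir) _ Fm _ (pF _ ir)) => //.
- move=> a; rewrite size_polyX => sa.
  by rewrite (size1_polyC sa) u_const chain_const_poly.
- by case: kF.
- have [_ aug] := chain_augmentation ir.
  by move=> a sa; rewrite (augmentation_small (chain_key ir) aug) // IHi // ltnW.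
by case: kF.
Qed.

Lemma root_chain_eq i g : (i < r)%N -> (size g < size (phi i.+1))%N ->
  u (f g) = mus i g%:F.
Proof.
move=> ir; apply: key_poly_rigid (chain_key ir) _ _ _ g => [c|g|].
- by rewrite u_const chain_const_poly // ltnW.
- exact: root_chain_le (ltnW ir).
have [lam0 aug] := chain_augmentation ir.
(* Strictness: [u] dominates [mus i.+1], which has gained [lam i.+1] at [phi i.+1]. *)
apply: lt_le_trans (root_chain_le (phi i.+1) ir).
rewrite (augmentation_key (chain_key ir) aug) chain_poly_value //.
by rewrite -EFinD lte_fin ltrDl.
Qed.

Lemma root_last_eq g : (size g < size F)%N -> u (f g) = mus r g%:F.
Proof.
apply: key_poly_rigid kF _ _ _ g => [c|g|].
- by rewrite u_const chain_const_poly.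
- exact: root_chain_le.
by rewrite uF vfun_lty tofrac_eq0 monic_neq0 // (key_poly_monic kF).
Qed.

End Root.

End Chain.

End Chains.

(** * Irreducibility over the completion *)

Section Completion.
Variables (K : fieldType) (v : valuation K).
Variables (Kv : fieldType) (w : valuation Kv) (iota : {rmorphism K -> Kv}).
Hypothesis Kv_completion : is_completion v w iota.
Variables (Kbar : closedFieldType) (vbar : valuation Kbar) (j : {rmorphism Kv -> Kbar}).
Hypothesis Kbar_closure : is_closure w vbar j.

Definition eval_at (theta : Kbar) : {rmorphism {poly K} -> Kbar} :=
  horner_eval theta \o map_poly j \o map_poly iota.

Lemma eval_atE theta g : eval_at theta g = (map_poly j (map_poly iota g)).[theta].
Proof. by []. Qed.

Lemma eval_at_const theta c : vbar (eval_at theta c%:P) = v c.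
Proof.
case: Kv_completion => wv _ _; case: Kbar_closure => _ vw.
by rewrite eval_atE !map_polyC hornerC -wv -vw.
Qed.

Lemma vfun_horner_gt (theta : Kbar) (p : {poly Kv}) (c : rat) :
    (0 <= vbar theta)%E -> (forall s, (c%:E < w p`_s)%E) ->
  (c%:E < vbar (map_poly j p).[theta])%E.
Proof.
move=> theta0 lt; rewrite horner_coef; apply: (big_ind (fun x => c%:E < vbar x)%E).
- by rewrite vfun0 ltry.
- by move=> x y; apply: vfun_gt_add.
move=> s _; rewrite coef_map vfunM Kbar_closure.2.
have := vfunX_ge s theta0; rewrite mulr0 => le.
by rewrite -[c%:E]adde0; apply: lte_leD.
Qed.

(* A proper factor [q] of [F] over [Kv] would have a root [theta] at which
   monic polynomials over [K] close to [q] take arbitrarily large values,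
   against [chain_bound]. *)
Lemma key_poly_irreducible r mus phi lam F :
    MacLane_chain v r mus phi lam -> key_poly (mus r) F ->
  irreducible_poly (map_poly iota F).
Proof.
move=> chain kF; have sF := key_poly_size kF; have F0 := monic_neq0 (key_poly_monic kF).
split=> [|p sp1 dvd]; first by rewrite size_map_poly.
have F'0 : map_poly iota F != 0 by rewrite map_poly_eq0.
have p0 : p != 0 by apply: contraNneq F'0 => p0; rewrite p0 dvd0p in dvd.
rewrite -dvdp_size_eqp // eqn_leq dvdp_leq //= size_map_poly leqNgt; apply/negP => spF.
pose q := (lead_coef p)^-1 *: p.
have lc0 : (lead_coef p)^-1 != 0 by rewrite invr_eq0 lead_coef_eq0.
have qm : lead_coef q = 1 by rewrite lead_coefZ mulVf // lead_coef_eq0.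
have sq : size q = size p by rewrite size_scale.
have [theta rtheta] : exists theta, root (map_poly j q) theta.
  by apply/closed_rootP; rewrite size_map_poly sq.
have uF : vbar (eval_at theta F) = +oo%E.
  apply/eqP; rewrite vfun_eqy eval_atE -[_ == 0]/(root _ theta) -dvdp_XsubCl.
  by apply: (@dvdp_trans _ (map_poly j q)); rewrite ?dvdp_XsubCl // dvdp_map dvdpZl.
pose d := (size q).-1.
have defsq : size q = d.+1 by rewrite prednK // sq size_poly_gt0.
(* The bound of [chain_bound] for monic polynomials of degree [d], to be exceeded at [theta]. *)
pose c : rat := d%:R * chain_slope mus phi r.
have [_ dense _] := Kv_completion.
have [a aP] := choice (fun s => dense q`_s c).
(* Only the lower coefficients are approximated; the leading one is exactly 1, so [g] is monic. *)
pose g : {poly K} := 'X^d + \poly_(s < d) a s.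
have szg1 : (size (\poly_(s < d) a s) < size ('X^d : {poly K}))%N.
  by rewrite size_polyXn ltnS size_poly.
have sg : size g = d.+1 by rewrite size_polyDl // size_polyXn.
have gm : g \is monic by rewrite monicE lead_coefDl // lead_coefXn.
have lt : (c%:E < vbar (eval_at theta g))%E.
  have -> : eval_at theta g = (map_poly j (map_poly iota g - q)).[theta].
    by rewrite eval_atE rmorphB hornerD hornerN (rootP rtheta) subr0.
  apply: vfun_horner_gt => [|s].
    (* [theta] is integral, since its value is at least [mu_0 x = 0]. *)
    have gmu : is_gauss v (mus 0%N) by case: chain.
    have := root_chain_le chain (eval_at_const theta) kF uF 'X (leq0n r).
    by rewrite (gaussX gmu) eval_atE !map_polyX hornerX.
  rewrite coefB (coef_map_id0 _ _ (rmorph0 iota)) coefD coefXn coef_poly.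
  have [lts|] := ltnP s d.
    by rewrite ltn_eqF // add0r vfunBC.
  rewrite leq_eqVlt => /predU1P[<-|lts].
    by rewrite eqxx addr0 (rmorph1 iota) -/(lead_coef q) qm subrr vfun0 ltry.
  by rewrite gtn_eqF // addr0 (rmorph0 iota) nth_default ?defsq // subr0 vfun0 ltry.
have sgF : (size g < size F)%N by rewrite sg -defsq sq.
have := chain_bound chain (leqnn r) gm.
rewrite -(root_last_eq chain (eval_at_const theta) kF uF sgF) /deg sg.
by rewrite leNgt lt.
Qed.

End Completion.

(** * Verification of the Okutsu conditions *)

Theorem theorem6p9
  (K : fieldType) (v : valuation K) (v_disc : normalized_discrete v)
  (Kv : fieldType) (w : valuation Kv) (iota : {rmorphism K -> Kv})
  (Kv_completion : is_completion v w iota)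
  (Kbar : closedFieldType) (vbar : valuation Kbar) (j : {rmorphism Kv -> Kbar})
  (Kbar_closure : is_closure w vbar j)
  (mu : valuation {fraction {poly K}}) (mu_ind : inductive_valuation v mu)
  (r : nat) (mus : nat -> valuation {fraction {poly K}})
  (phi : nat -> {poly K}) (lam : nat -> rat)
  (chain : optimal_MacLane_chain v mu r mus phi lam)
  (F : {poly K}) (F_strong : strong_key_poly mu r phi F)
  (theta : Kbar) (F_theta : root (map_poly j (map_poly iota F)) theta) :
  okutsu_frame v w iota vbar j r phi (map_poly iota F) theta /\
  forall i, (0 < i <= r)%N ->
    okutsu_const iota vbar j r phi (map_poly iota F) theta i =
    chain_const mus phi i.
Proof.
case: chain => mchain mur incr; case: F_strong; rewrite -mur => kF strong.
have Fm := key_poly_monic kF; have sF := key_poly_size kF.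
have uc := eval_at_const Kv_completion Kbar_closure theta.
have uF : vbar (eval_at iota j theta F) = +oo%E.
  by rewrite eval_atE (rootP F_theta) vfun0.
(* The frame over [K], shifted by one: phi_(i+1), with phi_(r+1) = F. *)
pose next i := if i == r then F else phi i.+1.
have frameE i : (i <= r)%N ->
    frame_poly iota r phi (map_poly iota F) i.+1 = map_poly iota (next i).
  by move=> ir; rewrite /frame_poly eqSS /next; case: eqP.
have framePE i : (i <= r)%N ->
    frame_poly iota r phi (map_poly iota F) i = map_poly iota (phi i).
  by move=> ir; rewrite /frame_poly ltn_eqF.
have deg_iota (g : {poly K}) : deg (map_poly iota g) = deg g.
  by rewrite /deg size_map_poly.
have next_key i : (i <= r)%N -> key_poly (mus i) (next i).
  rewrite /next leq_eqVlt; case: eqP => [-> //|_] /= ir; exact: (chain_key mchain ir).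
have valE i (g : {poly K}) : (i <= r)%N -> (deg g < deg (next i))%N ->
    vbar (eval_at iota j theta g) = mus i g%:F.
  move=> ir; have := key_poly_size (next_key i ir); rewrite /deg => s1 sg.
  have {}sg : (size g < size (next i))%N by move: (size g) (size _) s1 sg; lia.
  move: sg; rewrite /next; case: eqP => [-> sg|/eqP ne sg].
    exact: (root_last_eq mchain uc kF uF).
  have {}ir : (i < r)%N by rewrite ltn_neqAle ne.
  exact: (root_chain_eq mchain uc kF uF ir).
(* Strength of [F] settles [i = r], optimality of the chain the smaller indices. *)
have deg_lt i : (0 < i <= r)%N -> (deg (phi i) < deg (next i))%N.
  case/andP=> i0 ir; rewrite /next; case: eqP => [E|/eqP ne].
    by case: strong => [r0|]; [rewrite E r0 in i0 | rewrite E].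
  by apply: incr; rewrite i0 ltn_neqAle ne.
have chain_polyE i : (0 < i)%N -> chain_poly phi i = phi i by case: i.
have deg0 i : (0 < i <= r)%N -> (0 < deg (phi i))%N.
  by case/andP=> i0 ir; rewrite -chain_polyE // (chain_deg_gt0 mchain).
have constE i : (i <= r)%N ->
    okutsu_const iota vbar j r phi (map_poly iota F) theta i =
    (chain_slope mus phi i)%:E.
  rewrite /okutsu_const; case: posnP => [-> _|i0 ir].
    by rewrite (chain_slope0 mchain).
  rewrite framePE // /slope deg_iota -eval_atE.
  have i0r : (0 < i <= r)%N by rewrite i0.
  rewrite (valE i) ?deg_lt // -chain_polyE // (chain_value mchain) // -EFinM.
  by rewrite mulrAC mulfV ?mul1r // pnatr_eq0 -lt0n (chain_deg_gt0 mchain).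
split; last first.
  move=> i /andP[i0 ir]; rewrite constE // /chain_const -(chain_polyE i) //.
  rewrite (chain_value mchain) // -EFinM mulrAC mulfV ?mul1r //.
  by rewrite pnatr_eq0 -lt0n (chain_deg_gt0 mchain).
split.
- split=> //; split; first by rewrite map_monic.
    have FO := chain_key_integral mchain (leqnn r) kF.
    have [wv _ _] := Kv_completion.
    rewrite qualifE; apply/(all_nthP 0) => s; rewrite size_map_poly coef_map => sFs.
    have : (0 <= v F`_s)%E := all_nthP 0 FO s sFs.
    by rewrite -wv => le0; exact: le0.
  exact: (key_poly_irreducible Kv_completion Kbar_closure mchain kF).
- move=> [|i] // ir; have kphi := chain_key mchain ir.
  split; first exact: (key_poly_monic kphi).
  exact: (chain_key_integral mchain (ltnW ir) kphi).
- move=> i i0r; split; first exact: deg0.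
  by case/andP: (i0r) => i0 ir; rewrite framePE // frameE // !deg_iota deg_lt.
move=> i ir; rewrite frameE // deg_iota; split; last first.
  move=> g gm _ /andP[dg sg]; rewrite constE // /slope deg_iota -eval_atE (valE i) //.
  have d0 : (0 : rat) < (deg g)%:R by rewrite ltr0n.
  rewrite lee_pdivrMr // -EFinM mulrC.
  exact: (chain_bound mchain ir gm).
rewrite constE //; move: ir; rewrite leq_eqVlt => /predU1P[->|ir].
  (* At [i = r] the next constant is +oo, as [F] vanishes at [theta] and has positive degree. *)
  rewrite /okutsu_const /= frameE // /next eqxx /slope -eval_atE uF gt0_mulye ?ltry //.
  by rewrite lte_fin invr_gt0 ltr0n deg_iota /deg -subn1 subn_gt0.
by rewrite constE // lte_fin (chain_slope_lt mchain).
Qed.
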